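(* Let $X$ be a Banach space of dimension greater than or equal to two with the convex point of continuity property (in particular, this covers spaces with the point of continuity property or with the Radon--Nikodým property). Then $X$ does not have the super alternative Daugavet property.
   Context: Banach spaces are over $\mathbb{K}$ ($\mathbb{R}$ or $\mathbb{C}$); $B_X$, $S_X$ denote the closed unit ball and the unit sphere of $X$; $\mathbb{T}=\{\theta\in\mathbb{K}:|\theta|=1\}$. $X$ has the super alternative Daugavet property (super ADP) if for every $x\in S_X$ and every non-empty relatively weakly open subset $W$ of $B_X$ with $W\cap S_X\neq\emptyset$, one has $\sup_{y\in W}\max_{\theta\in\mathbb{T}}\|x+\theta y\|=2$. A point of continuity of a set $A\subset X$ is a point of $A$ at which the identity map $(A,\text{weak})\to(A,\|\cdot\|)$ is continuous. A slice of a bounded set $A$ is a non-empty intersection of $A$ with an open half-space $\{x:\mathrm{Re}\,x^*(x)>c\}$, and a denting point of $A$ is a point of $A$ contained in slices of $A$ of arbitrarily small diameter. $X$ has the Radon--Nikodým property if every non-empty closed convex bounded subset of $X$ has a denting point; $X$ has the point of continuity property (respectively, the convex point of continuity property, CPCP) if every non-empty closed bounded (respectively, closed convex bounded) subset of $X$ has a point of continuity. *)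

(* Defs.v *)
From HB Require Import structures.
From mathcomp Require Import all_boot all_order all_algebra.
From mathcomp Require Import all_classical all_reals all_analysis.
From mathcomp Require Import complex.
Set Implicit Arguments.
Unset Strict Implicit.
Unset Printing Implicit Defensive.
Import Order.TTheory GRing.Theory Num.Theory.
Import numFieldNormedType.Exports.
Local Open Scope classical_set_scope.
Local Open Scope ring_scope.

(* Everything is defined over an arbitrary numFieldType K and is meant for
   K = R or K = R[i] with R : realType. In a normedModType K the norm takes
   its values in K; for K = R[i], x <= y means that y - x is a nonnegative
   real, so the order below always compares real scalars. *)

Section Defs.
Context {K : numFieldType}.
Implicit Type X : normedModType K.

Definition dual X := {f : {linear X -> K^o} | continuous f}.

Definition weak X : topologicalType :=
  sup_topology (fun f : dual X =>
    Topological.on (initial_topology (sval f : X -> K^o))).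

Definition dim_ge X (n : nat) : Prop :=
  exists v : 'I_n -> X, forall c : 'I_n -> K,
    \sum_(i < n) c i *: v i = 0 -> forall i, c i = 0.

Definition unit_ball X : set X := [set x | `|x| <= 1].
Definition unit_sphere X : set X := [set x | `|x| = 1].
Definition unimodular : set K := [set t | `|t| = 1].

Definition rel_weakly_open X (A W : set X) : Prop :=
  exists2 U : set (weak X), open U & W = A `&` U.

Definition is_max (A : set K) (m : K) : Prop := A m /\ ubound A m.

Definition super_ADP X : Prop :=
  forall (x : X) (W : set X), unit_sphere x ->
    W !=set0 -> rel_weakly_open (@unit_ball X) W ->
    W `&` @unit_sphere X !=set0 ->
    isLub [set m | exists2 y, W y &
             is_max [set `|x + t *: y| | t in unimodular] m] 2.

Definition continuity_point X (A : set X) (a : X) : Prop :=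
  A a /\ (fun x : weak X => x : X) @ within A (nbhs (a : weak X)) --> a.

Definition PCP X : Prop :=
  forall A : set X, A !=set0 -> closed A -> bounded_set A ->
    exists a, continuity_point A a.

Definition CPCP X : Prop :=
  forall A : set X, A !=set0 -> closed A ->
    convex_set (A : set (convex_lmodType X)) -> bounded_set A ->
    exists a, continuity_point A a.

Section RadonNikodym.
(* re is the real part: the identity for K = R, complex.Re for K = R[i]. *)
Context {R : realType} (re : K -> R).

Definition slice X (A S : set X) : Prop :=
  S !=set0 /\ exists (f : dual X) (c : R), S = A `&` [set x | c < re (sval f x)].

Definition denting_point X (A : set X) (a : X) : Prop :=
  A a /\ forall e : K, 0 < e -> exists S : set X,
    [/\ slice A S, S a & forall y z, S y -> S z -> `|y - z| <= e].

Definition RNP X : Prop :=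
  forall A : set X, A !=set0 -> closed A ->
    convex_set (A : set (convex_lmodType X)) -> bounded_set A ->
    exists a, denting_point A a.

End RadonNikodym.
End Defs.

(* Main.v *)
From HB Require Import structures.
Require Import Defs.
From mathcomp Require Import all_boot all_order all_algebra.
From mathcomp Require Import all_classical all_reals all_analysis.
From mathcomp Require Import complex.
From mathcomp Require Import ring lra.

(* In a space with the super ADP, a point of continuity a of the ball lying on
   the sphere is a spear vector: max_t |x + t a| = 2 for every unit x, the
   maximum being over unimodular scalars t.  Then for every x there is t among
   1, -1 (or 1, -1, i, -i) with |x + t a| >= |x| + k, for a constant k > 0.  By
   Zorn's lemma this property of the norm passes to a linear functional below
   the norm: one f in the dual is nonzero at all spear vectors.  On the other
   hand, the CPCP gives a point of continuity of the intersection of the ball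
   with ker f.  It is also a point of continuity of the ball, and either it has
   norm 1, or all points of the ball are points of continuity; since
   dim X >= 2, in both cases f vanishes at some spear vector. *)

Set Implicit Arguments.
Unset Strict Implicit.
Unset Printing Implicit Defensive.
Import Order.TTheory GRing.Theory Num.Theory.
Import numFieldNormedType.Exports.
Local Open Scope classical_set_scope.
Local Open Scope ring_scope.

(** * Sublinear functionals and a constrained Hahn-Banach theorem *)

Section SublinearMinorant.
Context {R : realType} {V : lmodType R}.
Implicit Types (p q : V -> R) (S : set (seq V)) (k : R).

Definition sublinear p :=
  (forall x y, p (x + y) <= p x + p y) /\
  (forall t x, 0 < t -> p (t *: x) = t * p x).

(** For linear [p] this says that each list in [S] has an entry where [p] is at least [k]. Lists are
    finite so that the condition survives infima of directed families. *)
Definition escapes S k p :=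
  forall s, S s -> forall x, exists2 b, b \in s & p x + k <= p (x + b).

Lemma sublinear0 p : sublinear p -> p 0 = 0.
Proof.
by case=> _ /(_ 2 0 (ltr0Sn _ 1)); rewrite scaler0; lra.
Qed.

Lemma sublinear_ge_opp p x : sublinear p -> - p (- x) <= p x.
Proof.
by move=> sp; have := sp.1 x (- x); rewrite subrr (sublinear0 sp); lra.
Qed.

(** Serves both limits along a direction and chains in Zorn's lemma, hence sums and multiples may
    move to another index. The bound [l] keeps the infima finite. *)
Lemma sublinear_inf S k (I : Type) (i0 : I) (h : I -> V -> R) (l : V -> R) :
  (forall i x, l x <= h i x) ->
  (forall i j, exists m, forall x y, h m (x + y) <= h i x + h j y) ->
  (forall i t, 0 < t -> exists m, forall x, h m (t *: x) <= t * h i x) ->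
  (forall i j, exists m, forall x, h m x <= h i x /\ h m x <= h j x) ->
  (forall i, escapes S k (h i)) ->
  let q x := inf (range (h^~ x)) in
  [/\ sublinear q, escapes S k q & forall i x, q x <= h i x].
Proof.
move=> hl hD hZ hdir hS q.
have qh i x : q x <= h i x.
  by apply: ge_inf; [exists (l x) => _ [j _ <-]|exists i].
have qge x c : (forall i, c <= h i x) -> c <= q x.
  move=> ch; apply: lb_le_inf; first by exists (h i0 x), i0.
  by move=> _ [j _ <-].
have qlt x c : q x < c -> exists i, h i x < c.
  move=> qc; apply: contrapT => /forallNP nh.
  suff : c <= q x by rewrite leNgt qc.
  by apply: qge => i; rewrite leNgt; apply/negP/nh.
split=> //; first split.
- move=> x y; rewrite leNgt; apply/negP => lt_q.
  pose e := (q (x + y) - q x - q y) / 2.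
  have [i hi] : exists i, h i x < q x + e by apply: qlt; rewrite /e; lra.
  have [j hj] : exists j, h j y < q y + e by apply: qlt; rewrite /e; lra.
  have [m hm] := hD i j.
  by have := qh m (x + y); have := hm x y; move: hi hj; rewrite /e; lra.
- have le_qZ t x : 0 < t -> q (t *: x) <= t * q x.
    move=> t0; rewrite -ler_pdivrMl//; apply: qge => i.
    rewrite ler_pdivrMl//; have [m hm] := hZ i t t0.
    exact: le_trans (qh m _) (hm x).
  move=> t x t0; apply/eqP; rewrite eq_le le_qZ//=.
  have := le_qZ t^-1 (t *: x); rewrite invr_gt0 scalerA mulVf ?gt_eqF//.
  by rewrite scale1r => /(_ t0); rewrite ler_pdivlMl.
- move=> s Ss x; apply: contrapT => nb.
  (* By directedness, finitely many strict inequalities hold at a common index [i]. As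
     [q x <= h i x], this contradicts that [h i] escapes. *)
  have /= [i hi] : exists i, forall b, b \in s -> h i (x + b) < q x + k.
    have {nb} : forall b, b \in s -> q (x + b) < q x + k.
      by move=> b bs; rewrite ltNge; apply/negP => ?; apply: nb; exists b.
    elim: (s) => [|b s' IH] qs; first by exists i0.
    have [i hi] : exists i, forall b, b \in s' -> h i (x + b) < q x + k.
      by apply: IH => c cs; apply: qs; rewrite inE cs orbT.
    have [j hj] := qlt _ _ (qs b (mem_head _ _)).
    have [m hm] := hdir i j; exists m => c; rewrite inE => /orP[/eqP->|cs].
      exact: le_lt_trans (hm _).2 hj.
    exact: le_lt_trans (hm _).1 (hi _ cs).
  have [b bs hb] := hS i _ Ss x.
  have := hi _ bs; have := qh i x; lra.
Qed.

(* q x is the limit of p (x + t *: y) - t * p y as t tends to +oo. *)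
Lemma escapes_directional S k p y : sublinear p -> escapes S k p ->
  exists q, [/\ sublinear q, escapes S k q, forall x, q x <= p x &
                q (- y) <= - p y].
Proof.
move=> sp Sp; have [pD pZ] := sp.
pose h (t : {t : R | 0 <= t}) x := p (x + sval t *: y) - sval t * p y.
have pMy t : 0 <= t -> p (t *: y) = t * p y.
  rewrite le_eqVlt => /predU1P[<-|/pZ //].
  by rewrite scale0r mul0r sublinear0.
pose zero : {t : R | 0 <= t} := exist _ 0 (lexx _).
pose one : {t : R | 0 <= t} := exist _ 1 ler01.
have h_homo i j x : sval i <= sval j -> h j x <= h i x.
  move=> ij; rewrite /h -(subrK (sval i) (sval j)) scalerDl mulrDl.
  have := pD (x + sval i *: y) ((sval j - sval i) *: y).
  by rewrite pMy ?subr_ge0// -addrA [_ *: y + _]addrC; lra.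
(* Subadditivity gives the lower bound; each [h t] escapes because it is a translate of [p] minus a
   constant. *)
have [|||||sq Sq qh] := @sublinear_inf S k _ zero h (fun x => - p (- x)).
- move=> [t t0] x; rewrite /h/=.
  have := pD (x + t *: y) (- x); rewrite addrAC subrr add0r pMy//; lra.
- move=> [s s0] [t t0]; exists (exist _ (s + t) (addr_ge0 s0 t0)) => x z.
  rewrite /h/= scalerDl addrACA mulrDl.
  have := pD (x + s *: y) (z + t *: y); lra.
- move=> [s s0] t t0; exists (exist _ (t * s) (mulr_ge0 (ltW t0) s0)) => x.
  by rewrite /h/= -scalerA -scalerDr pZ// mulrBr mulrA.
- move=> i j; have [ij|/ltW ji] := leP (sval i) (sval j).
    by exists j => x; split=> //; exact: h_homo.
  by exists i => x; split=> //; exact: h_homo.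
- move=> [t t0] s Ss x; have [b bs pb] := Sp _ Ss (x + t *: y).
  by exists b => //; rewrite /h/= [x + b + _]addrAC; lra.
exists (fun x => inf (range (h^~ x))); split=> // [x|].
  by have := qh zero x; rewrite /h/= scale0r addr0 mul0r subr0.
(* The value at [t = 1] already gives the bound: [p (- y + y) - p y = - p y]. *)
have := qh one (- y); rewrite /h/= scale1r addNr (sublinear0 sp) mul1r.
by rewrite sub0r.
Qed.

(* Hahn-Banach with a constraint: by escapes_directional, a minimal element
   among the sublinear q <= p that escape S is odd, hence linear. *)
Lemma escapes_linear_minorant S k p : sublinear p -> escapes S k p ->
  exists f : {linear V -> R^o}, (forall x, f x <= p x) /\
    forall s, S s -> exists2 b, b \in s & k <= f b.
Proof.
move=> sp Sp.
pose P q := [/\ sublinear q, escapes S k q & forall x, q x <= p x].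
pose T := {q : V -> R | P q}.
(* The order is reversed: maximal for Zorn's lemma means pointwise minimal. *)
pose below (q r : T) := `[< forall x, sval r x <= sval q x >].
pose p0 : T := exist P p (And3 sp Sp (fun x => lexx (p x))).
have [||A totA|[q [sq Sq qp]] qmin] := @ZL_preorder T p0 below.
- by move=> q; apply/asboolP => x.
- move=> q r s /asboolP rq /asboolP sr; apply/asboolP => x.
  exact: le_trans (sr x) (rq x).
- have [[r Ar]|A0] := pselect (exists r, A r); last first.
    by exists p0 => r Ar; case: A0; exists r.
  pose I := {r : T | A r}; pose h (i : I) := sval (sval i).
  have hdir (i j : I) : exists m, forall x, h m x <= h i x /\ h m x <= h j x.
    have [/asboolP ij|/asboolP ji] := totA _ _ (svalP i) (svalP j).
      by exists j => x; split; [exact: ij|].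
    by exists i => x; split; [|exact: ji].
  have hP (i : I) : P (h i) by exact: svalP (sval i).
  have [|||||sq Sq qh] :=
    @sublinear_inf S k I (exist _ r Ar) h (fun x => - p (- x)).
  + move=> i x; have [si _ ip] := hP i.
    by have := sublinear_ge_opp x si; have := ip (- x); lra.
  + move=> i j; have [m hm] := hdir i j; exists m => x y.
    have [[mD _] _ _] := hP m.
    apply: le_trans (mD x y) _; apply: lerD; [exact: (hm _).1|exact: (hm _).2].
  + by move=> i t t0; exists i => x; have [[_ iZ] _ _] := hP i; rewrite iZ.
  + exact: hdir.
  + by move=> i; have [] := hP i.
  have qp x : inf (range (h^~ x)) <= p x.
    by apply: le_trans (qh (exist _ r Ar) x) _; have [] := hP (exist _ r Ar).
  exists (exist P _ (And3 sq Sq qp)) => s As; apply/asboolP => x /=.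
  exact: (qh (exist _ s As)).
have qN y : q (- y) = - q y.
  have [r [sr Sr rq ry]] := escapes_directional y sq Sq.
  have rp x : r x <= p x by exact: le_trans (rq x) (qp x).
  have /asboolP /= qr :
      below (exist P r (And3 sr Sr rp)) (exist P q (And3 sq Sq qp)).
    by apply: qmin; exact/asboolP.
  apply/eqP; rewrite eq_le (le_trans (qr _) ry)/=.
  by have := sublinear_ge_opp (- y) sq; rewrite opprK.
have [qD qZ] := sq.
have qadd x y : q (x + y) = q x + q y.
  apply/eqP; rewrite eq_le qD/=.
  by have := qD (x + y) (- y); rewrite addrK qN; lra.
have qlin : linear (q : V -> R^o).
  move=> t x y; rewrite qadd; congr (_ + _).
  have [t0|t0|<-] := ltgtP 0 t.
  - exact: qZ.
  - rewrite -[t in LHS]opprK scaleNr qN qZ ?oppr_gt0//.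
    by rewrite mulNr opprK.
  - by rewrite !scale0r sublinear0.
pose mx := GRing.isLinear.Build R V R^o _ q qlin.
pose f : {linear V -> R^o} := HB.pack q mx.
(* At the origin, escaping reads [k <= f b]. *)
exists f; split=> // s Ss; have [b bs] := Sq _ Ss 0.
by rewrite add0r (sublinear0 sq) add0r => kb; exists b.
Qed.

End SublinearMinorant.

(** * Weak convergence and transfer of points of continuity *)

Section WeakTopology.
Context {K : numFieldType} {X : normedModType K}.
Implicit Types (A C : set X) (a b u v x y : X) (f g : dual X).

Lemma cvg_to_eq {T : Type} {U : topologicalType} (F : set_system T)
  (h : T -> U) (l m : U) : h @ F --> l -> l = m -> h @ F --> m.
Proof. by move=> hl <-. Qed.

Lemma cvg_weakP (F : set_system X) (a : X) : Filter F ->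
  F --> (a : weak X) <-> forall f, sval f @ F --> (sval f a : K^o).
Proof.
move=> FF; rewrite cvg_sup; split=> Fa f.
- move=> U /= fU; apply: (Fa f).
  exact: (@initial_continuous X K^o (sval f) a).
- move=> U /=; rewrite (@nbhsE (initial_topology (sval f : X -> K^o))).
  move=> [B [[D oD <-] Da] BU]; apply: filterS BU _.
  by apply: (Fa f); exact: open_nbhs_nbhs.
Qed.

Lemma weak_cvg_dual A a f :
  sval f @ within A (nbhs (a : weak X)) --> (sval f a : K^o).
Proof.
by apply: (cvg_weakP _ _).1; exact: cvg_within.
Qed.

(** The tool for moving points of continuity between sets: below, the identity of the ball is
    recovered continuously from a map [phi] into [C], so norm convergence of [phi] is enough. *)
Lemma continuity_point_cvg C a (F : set_system X) (phi : X -> X) : Filter F ->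
  continuity_point C a -> (\forall y \near F, C (phi y)) ->
  (forall f, (fun y => sval f (phi y) : K^o) @ F --> (sval f a : K^o)) ->
  phi @ F --> a.
Proof.
move=> FF [Ca cont] FC Fw; apply: cvg_trans cont.
have Fa : phi @ F --> (a : weak X) by apply/cvg_weakP => f; exact: Fw.
move=> U /= CU; have := Fa _ CU; rewrite /= !nbhs_simpl /=.
by apply: filterS2 FC => y Cy; apply.
Qed.

Lemma continuity_point_nbhs A a (e : K) : 0 < e -> continuity_point A a ->
  exists U : set (weak X),
    [/\ open U, U a & forall y, A y -> U y -> `|a - y| < e].
Proof.
move=> e0 [Aa /cvgrPdist_lt /(_ e e0) Ae].
have : nbhs (a : weak X) [set y | A y -> `|a - y| < e] by exact: Ae.
rewrite nbhsE => -[U [oU Ua] UA].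
by exists U; split=> // y Ay Uy; exact: UA.
Qed.

(* A neighbourhood of b in the ball is mapped into a small neighbourhood
   of a in the ball by y |-> a + s (y - b) with s small. *)
Lemma continuity_point_unit_ball a b :
  continuity_point (@unit_ball K X) a -> `|a| < 1 -> `|b| <= 1 ->
  continuity_point (@unit_ball K X) b.
Proof.
move=> ca a1 b1; split=> //; set F := within _ _.
have FF : Filter F by exact: within_filter.
have FB : F (@unit_ball K X) by exact: withinT.
(* Points of the ball are at distance at most 2 from [b], so this [s] keeps [psi] in the ball. *)
pose s := (1 - `|a|) / 2.
have s0 : 0 < s by rewrite divr_gt0// subr_gt0.
pose psi y := a + s *: (y - b).
have psia : psi @ F --> a.
  apply: continuity_point_cvg ca _ _.
  - apply: filterS FB => y; rewrite /unit_ball/= => y1.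
    rewrite /psi (le_trans (ler_normD _ _))// normrZ gtr0_norm//.
    have : s * `|y - b| <= s * 2.
      rewrite ler_pM2l//; apply: le_trans (ler_normB _ _) _.
      by rewrite (_ : 2 = 1 + 1) ?lerD.
    by rewrite divfK// -(lerD2l `|a|) addrCA subrr addr0.
  - move=> f; rewrite /psi.
    under eq_fun do rewrite linearD linearZ linearB/=.
    apply: cvg_to_eq.
      apply: cvgD; first exact: cvg_cst.
      apply: cvgZl_tmp; apply: cvgB; [exact: weak_cvg_dual|exact: cvg_cst].
    by rewrite subrr scaler0 addr0.
have -> : (fun x : weak X => x : X) = (fun y => b + s^-1 *: (psi y - a)).
  apply/funext => y; rewrite /psi addrAC subrr add0r scalerA mulVf ?gt_eqF//.
  by rewrite scale1r addrC subrK.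
apply: cvg_to_eq.
  apply: cvgD; first exact: cvg_cst.
  by apply: cvgZl_tmp; apply: cvgB; [exact: psia|exact: cvg_cst].
by rewrite subrr scaler0 addr0.
Qed.

(* Points of the ball close to the hyperplane f = 0 are pushed into it, at the
   cost of a small change of norm. *)
Lemma continuity_point_hyperplane f a :
  continuity_point (@unit_ball K X `&` [set x | sval f x = 0]) a ->
  continuity_point (@unit_ball K X) a.
Proof.
have [f0|/existsNP[u0 fu0]] := pselect (forall x, sval f x = 0).
  rewrite (_ : [set x | _] = setT) ?setIT//.
  by apply/seteqP; split=> x //= _; exact: f0.
pose u := (sval f u0)^-1 *: u0.
have fu : sval f u = 1 by rewrite linearZ/= [LHS]mulVf//; exact/eqP.
move=> ca; have [[a1 fa] _] := ca; split=> //; set F := within _ _.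
have FF : Filter F by exact: within_filter.
have FB : F (@unit_ball K X) by exact: withinT.
(* [r y] bounds the norm of the projection of [y] to the kernel along [u], so [phi y] stays in the
   ball; it tends to 1 since [f y] tends to [f a = 0]. *)
pose r y := 1 + `|sval f y| * `|u|.
have r_gt0 y : 0 < r y by rewrite ltr_pwDl// mulr_ge0.
pose phi y := (r y)^-1 *: (y - sval f y *: u).
have fF : sval f @ F --> (0 : K^o) by rewrite -fa; exact: weak_cvg_dual.
have rF : r @ F --> (1 : K^o).
  apply: cvg_to_eq.
    by apply: cvgD; [exact: cvg_cst|apply: cvgMr_tmp; exact: cvg_norm fF].
  by rewrite normr0 mul0r addr0.
have phia : phi @ F --> a.
  apply: continuity_point_cvg ca _ _.
  - apply: filterS FB => y; rewrite /unit_ball/= => y1; split=> /=.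
      rewrite /phi normrZ gtr0_norm ?invr_gt0// ler_pdivrMl// mulr1.
      by rewrite (le_trans (ler_normB _ _))// normrZ lerD2r.
    by rewrite /phi linearZ linearB/= linearZ/= fu [_ *: 1]mulr1 subrr scaler0.
  - move=> g; rewrite /phi.
    under eq_fun do rewrite linearZ linearB/= linearZ/=.
    apply: cvg_to_eq.
      apply: cvgZ; first exact: (cvgV (oner_neq0 K)).
      apply: cvgB; [exact: weak_cvg_dual|exact: cvgZr_tmp fF].
    by rewrite invr1 scale1r scale0r subr0.
have -> : (fun x : weak X => x : X) = (fun y => r y *: phi y + sval f y *: u).
  apply/funext => y; rewrite /phi scalerA mulfV ?gt_eqF//.
  by rewrite scale1r subrK.
apply: cvg_to_eq.
  by apply: cvgD; [exact: cvgZ rF phia|exact: cvgZr_tmp fF].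
by rewrite scale1r scale0r addr0.
Qed.

End WeakTopology.

(** * Spear vectors, and points of continuity on the sphere *)

Section SuperADP.
Context {K : numFieldType} {X : normedModType K}.
Implicit Types (a u v x y : X) (f : dual X).

Definition spear a := forall x, `|x| = 1 -> forall e : K, 0 < e ->
  exists2 t : K, `|t| = 1 & 2 - e < `|x + t *: a|.

(** Some relative weak neighbourhood of [a] in the ball lies within [e / 2] of [a]. If all norms of
    [x + t *: a] were at most [2 - e], then on it the supremum would be at most [2 - e / 2]. *)
Lemma super_ADP_spear a : super_ADP X -> `|a| = 1 ->
  continuity_point (@unit_ball K X) a -> spear a.
Proof.
move=> sADP a1 ca x x1 e e0.
have e20 : 0 < e / 2 by rewrite divr_gt0.
have [U [oU Ua UB]] := continuity_point_nbhs e20 ca.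
pose W := @unit_ball K X `&` (U : set X).
have Wa : W a by split=> //; rewrite /unit_ball/= a1.
have [|||_ lub] := sADP x W x1.
- by exists a.
- by exists U.
- by exists a.
apply: contrapT => nt; have : ~ (2 <= 2 - e / 2 :> K).
  by rewrite lerDl oppr_ge0 lt_geF.
apply; apply: lub => m [y [By Uy] [[t t1 <-] _]].
have real_xa : 2 - e \is Num.real by rewrite rpredB ?realn// gtr0_real.
have : `|x + t *: a| <= 2 - e.
  rewrite real_leNgt ?normr_real//; apply/negP => lt_xa.
  by apply: nt; exists t.
have -> : x + t *: y = (x + t *: a) - t *: (a - y).
  by rewrite scalerBr opprB addrA addrAC addrK.
move=> le_xa; apply: le_trans (ler_normB _ _) _.
rewrite normrZ t1 mul1r [X in _ <= _ - X](_ : _ = e - e / 2); last first.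
  by rewrite {2}[e]splitr addrK.
by rewrite opprB addrA addrAC lerD// ltW// UB.
Qed.

Lemma continuity_point_sphere a v : v != 0 ->
  continuity_point (@unit_ball K X) a ->
  `|a| = 1 \/ continuity_point (@unit_ball K X) (`|v|^-1 *: v).
Proof.
move=> v0 ca; have [a1|a1] := eqVneq `|a| 1; [by left|right].
apply: (continuity_point_unit_ball ca).
  by rewrite lt_neqAle a1; case: ca.
by rewrite normrZ ger0_norm ?invr_ge0// mulVf ?normr_eq0.
Qed.

Lemma kernel_nontrivial f : dim_ge X 2 -> exists2 v, v != 0 & sval f v = 0.
Proof.
move=> [w free_w]; pose w0 := w ord0; pose w1 := w (lift ord0 ord0).
have free c0 c1 : c0 *: w0 + c1 *: w1 = 0 -> c0 = 0 /\ c1 = 0.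
  move=> c01.
  have := free_w (fun i => if i == ord0 then c0 else c1).
  rewrite big_ord_recl big_ord1 /= => /(_ c01) c_eq0.
  by split; [exact: (c_eq0 ord0)|exact: (c_eq0 (lift ord0 ord0))].
have [f0|f0] := eqVneq (sval f w0) 0.
  exists w0 => //; apply/eqP => w00.
  have /free[/eqP] : 1 *: w0 + 0 *: w1 = 0.
    by rewrite w00 scaler0 scale0r addr0.
  by rewrite oner_eq0.
(* Nonzero by independence, as the coefficient of [w1] is nonzero. *)
exists (sval f w1 *: w0 - sval f w0 *: w1).
  apply/eqP; rewrite -scaleNr => /free[_ /eqP].
  by rewrite oppr_eq0 (negPf f0).
have mul_subC (s t : K) : s * t + t * - s = 0 by rewrite mulrN mulrC subrr.
by rewrite linearB !linearZ/=; exact: mul_subC.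
Qed.

Lemma closed_unit_ball : closed (@unit_ball K X).
Proof.
rewrite -openC openE => x /= /negP.
rewrite -real_ltNge ?realn ?normr_real// => x1.
rewrite /interior; apply/nbhs_normP.
exists (`|x| - 1); first by rewrite /= subr_gt0.
move=> y /= xy; apply/negP; rewrite -real_ltNge ?realn ?normr_real//.
rewrite ltrBrDr in xy; rewrite -(ltrD2l `|x - y|) (lt_le_trans xy)//.
by rewrite -{1}(subrK y x) ler_normD.
Qed.

Lemma CPCP_hyperplane_point f : dim_ge X 2 -> CPCP X ->
  exists a, [/\ `|a| = 1, continuity_point (@unit_ball K X) a & sval f a = 0].
Proof.
move=> dimX cpcp; pose C := @unit_ball K X `&` [set x | sval f x = 0].
have [||||a ca] := cpcp C.
- by exists 0; split; rewrite /= ?linear0// /unit_ball/= normr0 ler01.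
- apply: closedI.
    exact: closed_unit_ball.
  rewrite (_ : [set x | _] = (sval f : X -> K^o) @^-1` [set 0 : K^o])//.
  apply: preimage_closed; first by move=> x _; exact: (svalP f).
  apply: accessible_closed_set1; apply: hausdorff_accessible.
  exact: norm_hausdorff.
- move=> x y l /set_mem[x1 fx] /set_mem[y1 fy]; apply/mem_set.
  have -> : conv l x y = l%:num *: (x : X) + (1 - l%:num) *: (y : X) :> X by [].
  have l1 : 0 <= 1 - l%:num by rewrite subr_ge0.
  split; last by rewrite /= linearD !linearZ/= fx fy !scaler0 addr0.
  rewrite /unit_ball/= (le_trans (ler_normD _ _))// !normrZ !ger0_norm//.
  by rewrite -[leRHS](subrKC l%:num) lerD// ler_piMr.
- by exists 1; split=> [|M /ltW M1 x [x1 _]]; [exact: real1|exact: le_trans M1].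
have [[a1 fa] _] := ca; have ba := continuity_point_hyperplane ca.
have [v v0 fv] := kernel_nontrivial f dimX.
have [a1'|bv] := continuity_point_sphere v0 ba; first by exists a.
exists (`|v|^-1 *: v); split=> //.
  by rewrite normrZ ger0_norm ?invr_ge0// mulVf ?normr_eq0.
by rewrite linearZ/= fv scaler0.
Qed.

(** The functional is a hypothesis because its construction depends on the scalar field. *)
Lemma CPCP_not_super_ADP :
  (exists f, forall a, `|a| = 1 -> spear a -> sval f a <> 0) ->
  dim_ge X 2 -> CPCP X -> ~ super_ADP X.
Proof.
move=> [f f_spear] dimX cpcp sADP.
have [a [a1 ca fa]] := CPCP_hyperplane_point f dimX cpcp.
exact: f_spear a1 (super_ADP_spear sADP a1 ca) fa.
Qed.

Lemma PCP_CPCP : PCP X -> CPCP X.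
Proof. by move=> pcp A A0 cA _; exact: pcp. Qed.

(** Slices are relatively weakly open once [re] has open upper level sets, so small slices at a
    denting point are small weak neighbourhoods. *)
Lemma RNP_CPCP (R : realType) (re : K -> R) :
  (forall c : R, open [set z : K^o | c < re z]) -> RNP re X -> CPCP X.
Proof.
move=> open_re rnp A A0 cA cvA bA; have [a [Aa denting]] := rnp A A0 cA cvA bA.
exists a; split=> //; apply/cvgrPdist_le => e e0.
have [S [[_ [f [c SE]]] Sa diam]] := denting e e0.
have : nbhs (a : weak X) [set y | A y -> S y].
  have aSf : nbhs (sval f a : K^o) [set z : K^o | c < re z].
    by apply: open_nbhs_nbhs; split=> //; move: Sa; rewrite SE => -[].
  have : \forall y \near (a : weak X), c < re (sval f y).
    exact: ((cvg_weakP _ _).1 (@cvg_id _ (nbhs (a : weak X))) f) _ aSf.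
  by apply: filterS => y fy Ay; rewrite SE.
by apply: filterS => y AS Ay; apply: diam => //; exact: AS.
Qed.

End SuperADP.

(** * From the spear condition to functionals: tools and the real case *)

Section SpearScaling.
Context {K : numFieldType} {X : normedModType K}.

(** Escaping is required from every point, so the spear inequality is carried from the unit vector
    [y] to its multiple [x] by the triangle inequality. *)
Lemma spear_scale (a x : X) (e : K) : spear a -> `|a| = 1 -> 0 < e ->
  exists2 t : K, `|t| = 1 & `|x| + 1 - e < `|x + t *: a|.
Proof.
move=> sa a1 e0; have [->|x0] := eqVneq x 0.
  exists 1; first exact: normr1.
  by rewrite normr0 !add0r scale1r a1 gtrBl.
pose y := `|x|^-1 *: x.
have nx : 0 < `|x| by rewrite normr_gt0.
have y1 : `|y| = 1 by rewrite normrZ ger0_norm ?invr_ge0// mulVf ?gt_eqF.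
have xy : x = `|x| *: y by rewrite scalerA mulfV ?scale1r// gt_eqF.
have [x1|/ltW x1] := real_leP (normr_real x) (real1 K).
- (* compare x with y, at distance 1 - |x| *)
  have [t t1 yt] := sa y y1 e e0; exists t => //.
  rewrite -(ltrD2r (1 - `|x|)) [ltLHS](_ : _ = 2 - e); last by ring.
  apply: lt_le_trans yt _.
  rewrite -[leLHS]normrN (_ : - _ = (x - y) - (x + t *: a)); last first.
    by rewrite !opprD addrACA subrr add0r.
  apply: le_trans (ler_normB _ _) _; rewrite addrC lerD2l.
  rewrite {1}xy -{2}[y]scale1r -scalerBl normrZ y1 mulr1 distrC.
  by rewrite ger0_norm ?subr_ge0.
- (* compare a with |x| a, at distance |x| - 1 *)
  have ex0 : 0 < e / `|x| by rewrite divr_gt0.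
  have [t t1 yt] := sa y y1 _ ex0; exists t => //.
  rewrite -(ltrD2r (`|x| - 1)) [ltLHS](_ : _ = `|x| * (2 - e / `|x|)); last first.
    by field; rewrite gt_eqF.
  move: yt; rewrite -(ltr_pM2l nx) => /lt_le_trans; apply.
  rewrite -{1}[`|x|]normr_id -normrZ scalerDr -xy.
  rewrite (_ : x + `|x| *: _ = (x + t *: a) + (`|x| - 1) *: (t *: a)); last first.
    by rewrite scalerBl scale1r addrACA subrr addr0.
  apply: le_trans (ler_normD _ _) _; rewrite lerD2l.
  by rewrite !normrZ t1 a1 !mulr1 ger0_norm ?subr_ge0.
Qed.

Lemma dual_of_bound (f : {linear X -> K^o}) (M : K) : M \is Num.real ->
  (forall x, `|f x| <= M * `|x|) -> exists g : dual X, sval g =1 f.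
Proof.
move=> Mreal fM; suff cf : continuous f by exists (exist _ f cf).
apply/linear_bounded_continuous/linear_boundedP.
exists M; split=> // r /ltW Mr x; apply: le_trans (fM x) _.
exact: ler_wpM2r.
Qed.

End SpearScaling.

(** Real unimodular scalars are 1 and -1, so the norm escapes all pairs [[:: a; - a]] with
    [k = 1 / 2]. A linear minorant with value at least [1 / 2] at [a] or [- a] cannot vanish at
    [a]. *)
Lemma real_spear_functional (R : realType) (X : normedModType R) :
  exists f : dual X, forall a, `|a| = 1 -> spear a -> sval f a <> 0.
Proof.
pose S := [set [:: a; - a] | a in [set a : X | `|a| = 1 /\ spear a]].
have norm_sublinear : sublinear (fun x : X => `|x|).
  by split=> [x y|t x t0]; [exact: ler_normD|rewrite normrZ gtr0_norm].
have norm_escapes : escapes S (1 / 2) (fun x : X => `|x|).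
  move=> _ [a [a1 sa] <-] x.
  have [|t t1 /ltW xt] := spear_scale x sa a1 (e := 1 / 2); first by lra.
  have tb : t *: a \in [:: a; - a].
    have /eqP := t1; rewrite eqr_norml ler01 andbT !inE.
    by move=> /orP[]/eqP->; rewrite ?scaleN1r ?scale1r eqxx ?orbT.
  by exists (t *: a) => //; move: xt; lra.
have [f [f_le fS]] := escapes_linear_minorant norm_sublinear norm_escapes.
have [x|g gf] := dual_of_bound (f := f) (real1 R).
  by rewrite mul1r ler_norml f_le lerNl -linearN -(normrN x) f_le.
exists g => a a1 sa; rewrite gf => fa.
have /fS[b] : S [:: a; - a] by exists a.
by rewrite !inE => /orP[]/eqP->; rewrite ?linearN fa; lra.
Qed.

(* A copy of X, so that its scaling by R does not compete with that by R[i]. *)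
Definition realification (R : realType) (X : lmodType R[i]) : Type := X.

(** * Restriction of scalars from [R[i]] to [R] *)

Section Realification.
Context {R : realType} {X : lmodType R[i]}.

HB.instance Definition _ := GRing.Zmodule.on (realification X).

Let scale (r : R) (x : realification X) : realification X :=
  (r%:C)%C *: (x : X).

Let scaleA r s x : scale r (scale s x) = scale (r * s) x.
Proof. by rewrite /scale scalerA rmorphM. Qed.

Let scale1 : left_id 1 scale.
Proof. by move=> x; rewrite /scale scale1r. Qed.

Let scaleDr : right_distributive scale +%R.
Proof. by move=> r x y; rewrite /scale scalerDr. Qed.

Let scaleDl x : {morph scale^~ x : r s / r + s}.
Proof. by move=> r s; rewrite /scale rmorphD scalerDl. Qed.

HB.instance Definition _ := GRing.Zmodule_isLmodule.Build R (realification X)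
  scaleA scale1 scaleDr scaleDl.

End Realification.

(** * Real parts and a finite net of the unit circle *)

Section ComplexScalars.
Context {R : realType}.
Implicit Types z w t : R[i].

Lemma ReD z w : complex.Re (z + w) = complex.Re z + complex.Re w.
Proof. by case: z w => [? ?] [? ?]. Qed.

Lemma ReB z w : complex.Re (z - w) = complex.Re z - complex.Re w.
Proof. by case: z w => [? ?] [? ?]. Qed.

Lemma ler_Re z w : z <= w -> complex.Re z <= complex.Re w.
Proof. by rewrite lecE => /andP[]. Qed.

Lemma ltr_Re z w : z < w -> complex.Re z < complex.Re w.
Proof. by rewrite ltcE => /andP[]. Qed.

(** Replaces the unit circle, since [escapes] takes finite lists. *)
Definition fourth_roots : seq R[i] := [:: 1; -1; 'i%C; - 'i%C].

Lemma near_fourth_root t : `|t| = 1 ->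
  exists2 w, w \in fourth_roots & complex.Re `|t - w| <= 4 / 5.
Proof.
have sqrt_le (r : R) : r <= (4 / 5) ^+ 2 -> Num.sqrt r <= 4 / 5.
  move=> r_le; rewrite -(@ger0_norm _ (4 / 5)); last by lra.
  by rewrite -sqrtr_sqr ler_wsqrtr.
case: t => u v t1.
have uv1 : u ^+ 2 + v ^+ 2 = 1.
  have /(congr1 (@complex.Re R)) := add_Re2_Im2 (Complex u v).
  by rewrite t1 expr1n.
(* One of [|u|], [|v|] is at least [7 / 10], so the squared distance to the matching root is at most
   [2 - 14 / 10], below [(4 / 5) ^+ 2]. *)
have [u7|u7] := leP (7 / 10) u.
  exists 1; first by rewrite !inE eqxx.
  by rewrite normc_def/=; apply: sqrt_le; nra.
have [u7'|u7'] := leP u (- (7 / 10)).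
  exists (-1); first by rewrite !inE eqxx orbT.
  by rewrite normc_def/=; apply: sqrt_le; nra.
have [v0|v0] := leP 0 v.
  exists 'i%C; first by rewrite !inE eqxx !orbT.
  by rewrite normc_def/=; apply: sqrt_le; nra.
exists (- 'i%C); first by rewrite !inE eqxx !orbT.
by rewrite normc_def/=; apply: sqrt_le; nra.
Qed.

End ComplexScalars.

(** * The functional in the complex case *)

Section ComplexFunctional.
Context {R : realType} {X : normedModType R[i]}.

(** The norm of [X] lies in [R[i]], while sublinear functionals are real valued. *)
Definition re_norm (x : realification X) : R := complex.Re `|x : X|.

Lemma re_norm_sublinear : sublinear re_norm.
Proof.
split=> [x y|t x t0].
  by rewrite /re_norm -ReD; apply: ler_Re; exact: ler_normD.
rewrite /re_norm [X in X = _](_ : _ = complex.Re (`|t%:C%C| * `|x : X|)).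
  by rewrite gtr0_norm ?ltcR//; case: `|_| => u v /=; rewrite mul0r subr0.
by rewrite -normrZ.
Qed.

(** The classical formula [f x = g x - i g (i x)] recovers a complex linear functional from its real
    part. *)
Lemma complexify_bound (g : {linear realification X -> R^o}) :
  (forall x, g x <= re_norm x) ->
  exists f : dual X, forall x, complex.Re (sval f x) = g x.
Proof.
move=> g_le.
have norm_g x : `|g x| <= re_norm x.
  rewrite ler_norml g_le andbT lerNl -linearN.
  by apply: le_trans (g_le _) _; rewrite /re_norm normrN.
pose f (x : X) : R[i]^o := (g x -i* g ('i%C *: x))%C.
have f_linear : linear f.
  move=> [c d] x y.
  have gZ (r s : R) (z : X) :
      g (Complex r s *: z) = r * g z + s * g ('i%C *: z).
    have -> : Complex r s *: z =
        r *: (z : realification X) + s *: ('i%C *: z : realification X).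
      rewrite (_ : Complex r s = r%:C%C + s%:C%C * 'i%C); last first.
        by rewrite [LHS]complexE mulrC.
      by rewrite scalerDl -scalerA.
    by rewrite linearD !linearZ.
  have gD (z w : X) : g (z + w : X) = g z + g w by exact: linearD.
  have iE : 'i%C *: (Complex c d *: x + y) = Complex (- d) c *: x + 'i%C *: y.
    rewrite scalerDr scalerA; congr (_ *: _ + _).
    by apply/eqP; rewrite eq_complex /=; apply/andP; split; apply/eqP; ring.
  rewrite /f iE !gD gZ (gZ (- d)); apply/eqP; rewrite eq_complex/=.
  by apply/andP; split; apply/eqP; ring.
pose mx := GRing.isLinear.Build R[i] X R[i]^o _ f f_linear.
pose F : {linear X -> R[i]^o} := HB.pack f mx.
(* The crude constant 2 bounds the two terms of [f] separately and is enough for continuity. *)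
have [|x|h hF] := @dual_of_bound _ _ F 2; first exact: realn.
  have nx : `|x| = (re_norm x)%:C%C by rewrite RRe_real ?normr_real.
  have gi := norm_g ('i%C *: x); have gx := norm_g x.
  have nix : re_norm ('i%C *: x) = re_norm x.
    by rewrite /re_norm normrZ normc_def/= expr0n expr1n add0r sqrtr1 mul1r.
  rewrite nix in gi.
  have -> : F x = (g x)%:C%C - 'i%C * (g ('i%C *: x))%:C%C :> R[i].
    by apply/eqP; rewrite eq_complex/=; apply/andP; split; apply/eqP; ring.
  apply: le_trans (ler_normB _ _) _; rewrite normrM nx.
  rewrite (_ : `|'i%C| = 1 :> R[i]) ?mul1r; last first.
    by rewrite normc_def/= expr0n expr1n add0r sqrtr1.
  by rewrite mulr_natl mulr2n lerD// normc_def/= expr0n addr0 sqrtr_sqr lecR.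
by exists h => x; rewrite hF.
Qed.

(** The spear inequality gains [1 - 1 / 10], and moving [t] to a nearby fourth root costs at most
    [4 / 5]; this leaves [k = 1 / 10]. If [f a = 0], then [f] vanishes at all [w *: a], against
    [k > 0]. *)
Lemma complex_spear_functional :
  exists f : dual X, forall a, `|a| = 1 -> spear a -> sval f a <> 0.
Proof.
pose s (a : X) : seq (realification X) := [seq w *: a | w <- fourth_roots].
pose S := [set s a | a in [set a : X | `|a| = 1 /\ spear a]].
have re_norm_escapes : escapes S (1 / 10) re_norm.
  move=> _ [a [a1 sa] <-] x.
  have e0 : 0 < (1 / 10)%:C%C :> R[i] by rewrite ltcR; lra.
  have [t t1 /ltr_Re xt] := spear_scale (x : X) sa a1 e0.
  have [w wF tw] := near_fourth_root t1.
  exists (w *: a : X); first by apply/mapP; exists w.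
  have : complex.Re `|x + t *: a : X| <=
      re_norm (x + w *: a) + complex.Re `|t - w|.
    rewrite /re_norm -ReD; apply: ler_Re.
    rewrite (_ : x + t *: a = (x + w *: a) + (t - w) *: a :> X); last first.
      by rewrite scalerBl addrACA subrr addr0.
    by apply: le_trans (ler_normD _ _) _; rewrite normrZ a1 mulr1.
  by move: xt tw; rewrite ReB ReD /= /re_norm; lra.
have [g [g_le gS]] := escapes_linear_minorant re_norm_sublinear re_norm_escapes.
have [f fg] := complexify_bound g_le.
exists f => a a1 sa fa.
have /gS[_ /mapP[w _ ->]] : S (s a) by exists a.
by rewrite -fg linearZ/= fa scaler0/=; lra.
Qed.

End ComplexFunctional.

(** * Complex half-planes, and the theorem over both fields *)

Lemma open_Re_gt (R : realType) (c : R) :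
  open [set z : R[i]^o | c < complex.Re z].
Proof.
rewrite openE => z /= cz; rewrite /interior.
apply/(@nbhs_normP R[i] R[i]^o); exists (complex.Re z - c)%:C%C.
  by rewrite /= ltcR subr_gt0.
move=> w /= zw; have /ltr_Re /= zw_lt := zw.
have := ler_Re (normc_ge_Re (z - w)); rewrite ReB /=.
by have := ler_norm (complex.Re z - complex.Re w); lra.
Qed.

Theorem theorem3p9 (R : realType) :
  (forall X : completeNormedModType R,
     [/\ (PCP X -> CPCP X),
         (RNP (fun t : R => t) X -> CPCP X)
       & (dim_ge X 2 -> CPCP X -> ~ super_ADP X)]) /\
  (forall X : completeNormedModType (complex R),
     [/\ (PCP X -> CPCP X),
         (RNP (@complex.Re R) X -> CPCP X)
       & (dim_ge X 2 -> CPCP X -> ~ super_ADP X)]).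
Proof.
split=> X; split.
- exact: PCP_CPCP.
- by apply: RNP_CPCP => c; exact: open_gt.
- exact: CPCP_not_super_ADP (real_spear_functional X).
- exact: PCP_CPCP.
- by apply: RNP_CPCP => c; exact: open_Re_gt.
- exact: CPCP_not_super_ADP (complex_spear_functional (X := X)).
Qed.
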